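(* For each $n\ge 3$ there exists a reducible superflow $\Delta_n$ of dimension $n$ (over $\mathbb{R}$) whose group of symmetries $\Gamma$ is of order $2\,n!$. As a group, $\Gamma$ is isomorphic to $S_n\oplus\mathbb{Z}_2$.
   Context: Projective flow: for $\Phi:\mathbb{R}^n\to\mathbb{R}^n$ (possibly defined only locally) put $\Phi^t(\mathbf{x})=t^{-1}\Phi(\mathbf{x}t)$. A projective flow is a solution of $\Phi^{t+s}=\Phi^t\circ\Phi^s$ with $\lim_{t\to0}\Phi(\mathbf{x}t)/t=\mathbf{x}$. Its vector field is $\frac{d}{dt}\big(t^{-1}\Phi(\mathbf{x}t)\big)|_{t=0}$; it is homogeneous of degree $2$. Superflow: let $n\ge2$ and let $\Gamma\hookrightarrow\mathrm{GL}(n,\mathbb{R})$ be a faithful representation of a finite group, identified with its image. A projective flow $\Phi$ is a $\Gamma$-superflow if (i) its vector field $\mathbf{Q}=(Q_1,\dots,Q_n)\ne 0$ has components that are rational functions homogeneous of degree $2$ and satisfies $\gamma^{-1}\circ\mathbf{Q}\circ\gamma=\mathbf{Q}$ for all $\gamma\in\Gamma$; and (ii) every other vector field $\mathbf{Q}'$ (with rational components homogeneous of degree $2$) satisfying $\gamma^{-1}\circ\mathbf{Q}'\circ\gamma=\mathbf{Q}'$ for all $\gamma\in\Gamma$ is either a scalar multiple of $\mathbf{Q}$ or has a common denominator of higher degree than that of $\mathbf{Q}$. One says that $\Gamma$ is the group of symmetries of the superflow. The superflow is reducible if the representation $\Gamma\hookrightarrow\mathrm{GL}(n,\mathbb{R})$,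 considered as a complex representation, is reducible. *)

(* Defs.v *)
From HB Require Import structures.
From mathcomp Require Import all_boot all_order all_algebra all_fingroup.
From mathcomp Require Import all_solvable all_character.
From mathcomp Require Import fraction complex.
From mathcomp Require mpoly.

Set Implicit Arguments.
Unset Strict Implicit.
Unset Printing Implicit Defensive.

Import Order.TTheory GRing.Theory Num.Theory.
Local Open Scope ring_scope.

(* The notations of [mpoly] clash with those of MathComp-Analysis: they are  *)
(* only imported inside this section, before MathComp-Analysis is loaded.    *)
Section RationalVectorFields.
Import mpoly.
Variables (R : fieldType) (n : nat).

Local Notation "p %:F" := (@FracField.tofrac {mpoly R[n]} p).

Definition ratfun : fieldType := {fraction {mpoly R[n]}}.

(* The i-th component of [Q : vfield] is [Q i 0]. *)
Definition vfield := 'cV[ratfun]_n.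

(* [r] is regular at [x], with value [v]. *)
Definition rat_value (r : ratfun) (x : 'cV[R]_n) (v : R) : Prop :=
  exists p q : {mpoly R[n]},
    [/\ r = p%:F / q%:F, q.@[fun i => x i 0] != 0
      & v = p.@[fun i => x i 0] / q.@[fun i => x i 0]].

Definition vfield_value (Q : vfield) (x v : 'cV[R]_n) : Prop :=
  forall i, rat_value (Q i 0) x (v i 0).

Definition rat_homog2 (r : ratfun) : Prop :=
  exists (d : nat) (p q : {mpoly R[n]}),
    [/\ p \is d.+2.-homog, q \is d.-homog, q != 0 & r = p%:F / q%:F].

Definition vfield_homog2 (Q : vfield) : Prop := forall i, rat_homog2 (Q i 0).

Definition poly_subst (g : 'M[R]_n) (p : {mpoly R[n]}) : {mpoly R[n]} :=
  p \mPo [tuple \sum_j g i j *: 'X_j | i < n].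

(* [r \o g], computed on a representative of [r]; for invertible [g] the     *)
(* choice of the representative is irrelevant, see [rat_substE].             *)
Definition rat_subst (g : 'M[R]_n) (r : ratfun) : ratfun :=
  (poly_subst g \n_(generic_quotient.repr r))%:F /
  (poly_subst g \d_(generic_quotient.repr r))%:F.

(* [g^-1 \o Q \o g] *)
Definition vfield_conj (g : 'M[R]_n) (Q : vfield) : vfield :=
  map_mx (fun c => (mpolyC n c)%:F) (invmx g) *m map_mx (rat_subst g) Q.

Definition vfield_scale (c : R) (Q : vfield) : vfield :=
  (mpolyC n c)%:F *: Q.

Definition common_denom (Q : vfield) (D : {mpoly R[n]}) : Prop :=
  D != 0 /\ forall i, exists p : {mpoly R[n]}, Q i 0 = p%:F / D%:F.

(* [d] is the degree of the least common denominator of [Q]; for [D != 0],   *)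
(* [msize D] is one more than the degree of [D].                             *)
Definition denom_degree (Q : vfield) (d : nat) : Prop :=
  (exists2 D, common_denom Q D & (msize D).-1 = d) /\
  (forall D, common_denom Q D -> d <= (msize D).-1)%N.

Lemma ratfun_repr (r : ratfun) :
  r = (\n_(generic_quotient.repr r))%:F / (\d_(generic_quotient.repr r))%:F.
Proof.
have d0 : \d_(generic_quotient.repr r) != 0 by exact: denom_ratioP.
apply: (mulIf (x := (\d_(generic_quotient.repr r))%:F)).
  by rewrite tofrac_eq0.
rewrite divfK ?tofrac_eq0 // -{1}[r]generic_quotient.reprK.
rewrite /FracField.tofrac; unlock.
rewrite -[LHS]FracField.pi_mul; apply/eqP; rewrite FracField.equivf_def.
by rewrite /FracField.mulf !numden_Ratio ?oner_neq0 ?mulr1 // mulrC.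
Qed.

Lemma poly_substK (g : 'M[R]_n) : g \in unitmx ->
  cancel (poly_subst g) (poly_subst (invmx g)).
Proof.
move=> gU p; rewrite /poly_subst.
have -> : (p \mPo [tuple \sum_j g i j *: 'X_j  | i < n])
  \mPo [tuple \sum_j (invmx g) i j *: 'X_j  | i < n] =
  p \mPo [tuple (\sum_j g i j *: 'X_j) \mPo
         [tuple \sum_j (invmx g) i j *: 'X_j  | i < n] | i < n].
  rewrite !(comp_mpolyE p) raddf_sum; apply: eq_bigr => m _.
  rewrite /= comp_mpolyZ rmorph_prod; congr (_ *: _); apply: eq_bigr => i _.
  by rewrite rmorphXn /= !tnth_mktuple.
rewrite -[RHS]comp_mpoly_id; congr comp_mpoly; apply: eq_from_tnth => i.
rewrite !tnth_mktuple raddf_sum /=.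
have -> : 'X_i = \sum_k (g *m invmx g) i k *: 'X_k :> {mpoly R[n]}.
  rewrite mulmxV // (bigD1 i) //= big1 ?addr0 ?mxE ?eqxx ?scale1r // => k.
  by rewrite mxE eq_sym => /negbTE->; rewrite scale0r.
transitivity (\sum_j \sum_k (g i j * invmx g j k) *: 'X_k : {mpoly R[n]}).
  apply: eq_bigr => j _; rewrite comp_mpolyZ comp_mpolyXU -tnth_nth.
  by rewrite tnth_mktuple scaler_sumr; under eq_bigr do rewrite scalerA.
rewrite exchange_big; apply: eq_bigr => k _.
by rewrite -scaler_suml mxE.
Qed.

Lemma rat_substE (g : 'M[R]_n) (p q : {mpoly R[n]}) :
    g \in unitmx -> q != 0 ->
  rat_subst g (p%:F / q%:F) = (poly_subst g p)%:F / (poly_subst g q)%:F.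
Proof.
move=> gU q0; rewrite /rat_subst; set r := generic_quotient.repr _.
have sub0 : poly_subst g 0 = 0 by exact: comp_mpoly0.
have subN0 s : s != 0 -> poly_subst g s != 0.
  apply: contra_neq => s0; apply: (can_inj (poly_substK gU)).
  by rewrite s0 sub0.
have fN0 (s : {mpoly R[n]}) : s != 0 -> s%:F != 0 by rewrite tofrac_eq0.
have d0 : \d_r != 0 by exact: denom_ratioP.
have rE : (\n_r)%:F / (\d_r)%:F = p%:F / q%:F by rewrite -ratfun_repr.
apply/eqP; rewrite eqr_div ?fN0 ?subN0 // -!rmorphM /= tofrac_eq.
move/eqP: rE; rewrite eqr_div ?fN0 // -!rmorphM /= tofrac_eq => /eqP rE.
by rewrite rE.
Qed.

End RationalVectorFields.

From mathcomp Require Import all_classical all_reals all_analysis.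
Import numFieldNormedType.Exports.
Local Open Scope classical_set_scope.

Section Superflows.
Variables (R : realType) (n : nat).
Local Notation V := 'cV[R]_n.

(* A locally defined map is a total function [Phi] together with the set [D] *)
(* of points at which it is defined; its values outside [D] are irrelevant.  *)
Implicit Types (D : set V) (Phi : V -> V).

(* [Phi^t(x)], extended to [t = 0] by its limit [x]. *)
Definition phi_t Phi (t : R) (x : V) : V :=
  if t == 0 then x else t^-1 *: Phi (t *: x).

Definition phi_def D (t : R) (x : V) : Prop := t = 0 \/ D (t *: x).

(* The points near which [Phi^t] is defined for all small [t]. *)
Definition flow_base D : set V :=
  [set x | \forall y \near x & t \near (0 : R), phi_def D t y].

Definition projective_flow D Phi : Prop :=
  [/\ flow_base D !=set0,
      forall x, flow_base D x -> t^-1 *: Phi (t *: x) @[t --> 0^'] --> x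
    & forall (x : V) (s t : R), phi_def D s x ->
        phi_def D t (phi_t Phi s x) -> phi_def D (t + s) x ->
        phi_t Phi (t + s) x = phi_t Phi t (phi_t Phi s x)].

Definition has_vector_field D Phi (Q : vfield R n) : Prop :=
  forall x v : V, vfield_value Q x v ->
    flow_base D x /\ is_derive (0 : R) 1 (fun t => phi_t Phi t x) v.

Variables (gT : finGroupType) (G : {group gT}) (rG : mx_representation R G n).

Definition vfield_invariant (Q : vfield R n) : Prop :=
  forall g, g \in G -> vfield_conj (rG g) Q = Q.

Definition superflow D Phi : Prop :=
  [/\ (2 <= n)%N, mx_faithful rG, projective_flow D Phi
    & exists Q : vfield R n,
      [/\ has_vector_field D Phi Q, Q != 0, vfield_homog2 Q,
          vfield_invariant Q
        & forall Q' : vfield R n, vfield_homog2 Q' -> vfield_invariant Q' ->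
            (exists c : R, Q' = vfield_scale c Q) \/
            (exists d d', [/\ denom_degree Q d, denom_degree Q' d' &
                              (d < d')%N])]].

Definition complex_reducible : Prop :=
  ~ mx_irreducible (map_repr (real_complex R) rG).

End Superflows.

(* Main.v *)
Require Import Defs.
From mathcomp Require Import all_boot all_order all_algebra all_fingroup.
From mathcomp Require Import all_solvable all_character.
From mathcomp Require Import fraction complex.
From mathcomp Require mpoly boolp.
From mathcomp Require Import ring lra.

Set Implicit Arguments.
Unset Strict Implicit.
Unset Printing Implicit Defensive.

Import Order.TTheory GRing.Theory Num.Theory.
Local Open Scope ring_scope.

(** Let S_n permute the coordinates and let z be the reflection that negates
    the constant vectors and fixes the vectors of mean zero; the line of
    constant vectors makes the representation of S_n x <z> reducible.  For an
    invariant polynomial field B(x, x), equivariance under z and S_n kills all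
    sums of the coefficients b_ijk over one index.  The coefficients take one
    value on each of the orbits iii, iij, ijj, ijk, so these linear relations
    leave a single parameter, b_iii.  The solution is x |-> C ((C x)^2), where
    C is the projection onto the vectors of mean zero; its denominator has
    degree 0, and any other invariant field has a denominator of positive
    degree.

    The flow is the sum of the Taylor series of the ODE x' = B(x, x), whose
    k-th coefficient is bounded by |x| (beta |x|)^k and is homogeneous of
    degree k + 1 in x, so that Phi is defined on the ball beta |x| < 1.  The
    translation equation is the uniqueness of solutions, by Gronwall. *)

(** * Coefficient arrays equivariant under permutations and the mean reflection *)

Section QuadraticArrays.
Variables (R : numFieldType) (n : nat).
Implicit Types (b : 'I_n -> 'I_n -> 'I_n -> R) (g : 'M[R]_n).

Definition symmetric_array b := forall i j k, b i j k = b i k j.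

(* [g] commutes with [x |-> (\sum_(j, k) b i j k * x_j * x_k)_i]. *)
Definition equivariant_array g b := forall i j k,
  \sum_j' \sum_k' b i j' k' * (g j' j * g k' k) = \sum_l g i l * b l j k.

(** Polarisation: expanding at [u + v] isolates twice the bilinear form, whose coefficients are read
    off at basis vectors. *)
Lemma qform_eq0 (c : 'I_n -> 'I_n -> R) : (forall j k, c j k = c k j) ->
  (forall v : 'I_n -> R, \sum_j \sum_k c j k * (v j * v k) = 0) ->
  forall j k, c j k = 0.
Proof.
move=> c_sym c0.
have bil u v : \sum_j \sum_k c j k * (u j * v k) = 0.
  have := c0 (fun i => u i + v i).
  have -> : \sum_j \sum_k c j k * ((u j + v j) * (u k + v k)) =
    \sum_j \sum_k c j k * (u j * u k) + \sum_j \sum_k c j k * (v j * v k) +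
    (\sum_j \sum_k c j k * (u j * v k) + \sum_j \sum_k c j k * (v j * u k)).
    rewrite -!big_split; apply: eq_bigr => j _.
    by rewrite -!big_split; apply: eq_bigr => k _ /=; ring.
  rewrite !c0 !add0r.
  have -> : \sum_j \sum_k c j k * (v j * u k) = \sum_j \sum_k c j k * (u j * v k).
    rewrite exchange_big; apply: eq_bigr => j _; apply: eq_bigr => k _.
    by rewrite c_sym (mulrC (v k)).
  by rewrite -mulr2n => /eqP; rewrite mulrn_eq0 => /eqP.
move=> j k; rewrite -[RHS](bil (fun i => (i == j)%:R) (fun i => (i == k)%:R)).
rewrite (bigD1 j) //= (bigD1 k) //= !eqxx !mulr1 [X in _ + X]big1 => [|i /negbTE iNj].
  rewrite big1 ?addr0 // => i /negbTE iNk.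
  by rewrite iNk !mulr0.
by rewrite big1 // => l _; rewrite iNj mul0r mulr0.
Qed.

(** The sum is [F k] times the number of indices with that value, a positive integer, when [F k] is
    nonzero; the characteristic is zero. *)
Lemma sum_two_valued_eq0 (F : 'I_n -> R) k :
  \sum_i F i = 0 -> (forall i, F i = 0 \/ F i = F k) -> F k = 0.
Proof.
move=> sumF F2; have [//|Fk0] := eqVneq (F k) 0.
move: sumF; have -> : \sum_i F i = \sum_(i | F i == F k) F k.
  rewrite [RHS]big_mkcond; apply: eq_bigr => i _; case: eqP => // FiN.
  by case: (F2 i).
rewrite sumr_const => /eqP; rewrite mulrn_eq0 (negbTE Fk0) orbF => /eqP.
by move/card0_eq/(_ k)/negbT/negP; case; apply/eqP.
Qed.

(** A permutation matrix has one nonzero entry per row and column, so at the indices [i], [s j],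
    [s k] every sum collapses to one term. *)
Lemma equivariant_perm_mx b (s : 'S_n) : equivariant_array (perm_mx s) b ->
  forall i j k, b (s i) (s j) (s k) = b i j k.
Proof.
move=> sb i j k; have := sb i (s j) (s k).
rewrite [RHS](bigD1 (s i)) //= (bigD1 j) //= (bigD1 k) //=.
rewrite !mxE !eqxx !mulr1 mul1r.
rewrite [X in _ + X + _]big1; last first.
  by move=> l lNk; rewrite !mxE (inj_eq perm_inj) (negbTE lNk) !mulr0.
rewrite [X in _ + _ + X = _]big1; last first.
  move=> l lNj; rewrite big1 // => m _.
  by rewrite !mxE (inj_eq perm_inj) (negbTE lNj) mul0r mulr0.
rewrite [X in _ = _ + X]big1 ?addr0 //.
by move=> l lNsi; rewrite !mxE (eq_sym (s i)) (negbTE lNsi) mul0r.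
Qed.

(* -1 on the constant vectors, the identity on the vectors of mean zero. *)
Definition mean_reflection : 'M[R]_n := 1%:M - const_mx (2%:R / n%:R).

Lemma mean_reflectionE i j :
  mean_reflection i j = (i == j)%:R - 2%:R / n%:R.
Proof. by rewrite !mxE. Qed.

Section Uniqueness.
Variable b : 'I_n -> 'I_n -> 'I_n -> R.
Hypothesis n_gt0 : (0 < n)%N.
Hypothesis b_sym : symmetric_array b.
Hypothesis b_perm : forall s : 'S_n, equivariant_array (perm_mx s) b.
Hypothesis b_refl : equivariant_array mean_reflection b.

Let bS (s : 'S_n) i j k : b (s i) (s j) (s k) = b i j k.
Proof. exact: equivariant_perm_mx. Qed.

Let n_neq0 : n%:R != 0 :> R. Proof. by rewrite pnatr_eq0 -lt0n. Qed.

Let constF (F : 'I_n -> R) :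
  (forall s : 'S_n, forall i, F (s i) = F i) -> \sum_i F i = 0 ->
  forall i, F i = 0.
Proof.
move=> Fs F0 i; apply: sum_two_valued_eq0 F0 _ => j; right.
by rewrite -(Fs (tperm i j) i) tpermL.
Qed.

(** Equivariance under the reflection expands to [c j k = r i j + r i k - e * t i]. Summing over [k]
    gives [C j = n * r i j - t i], and summing this over [j] gives total zero. By transitivity of
    [S_n], [t] and [C] are constant, hence zero, and then so are [r] and [c]. *)
Lemma equivariant_sums0 :
  (forall i j, \sum_k b i j k = 0) /\ (forall j k, \sum_i b i j k = 0).
Proof.
pose e : R := 2%:R / n%:R.
pose r i j := \sum_k b i j k; pose c j k := \sum_i b i j k.
pose t i := \sum_j r i j; pose C j := \sum_k c j k.
have refl i j k : c j k = r i j + r i k - e * t i.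
  have := b_refl i j k.
  have -> : \sum_l mean_reflection i l * b l j k = b i j k - e * c j k.
    rewrite mulr_sumr -[X in _ = X - _](@addr0 _ (b i j k)).
    transitivity (\sum_l (i == l)%:R * b l j k - \sum_l e * b l j k).
      by rewrite -sumrB; apply: eq_bigr => l _; rewrite mean_reflectionE mulrBl.
    congr (_ - _); rewrite (bigD1 i) //= eqxx mul1r big1 // => l lNi.
    by rewrite eq_sym (negbTE lNi) mul0r.
  have -> : \sum_j' \sum_k' b i j' k' *
      (mean_reflection j' j * mean_reflection k' k) =
      b i j k - e * r i k - e * r i j + e * e * t i.
    have inner j' : \sum_k' b i j' k' *
        (mean_reflection j' j * mean_reflection k' k) =
        mean_reflection j' j * (b i j' k - e * r i j').
      transitivity (mean_reflection j' j * (\sum_k' b i j' k' * (k' == k)%:R -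
           \sum_k' e * b i j' k')).
        rewrite -sumrB mulr_sumr; apply: eq_bigr => l _.
        by rewrite (mean_reflectionE l) -/e; ring.
      congr (_ * (_ - _)); last by rewrite mulr_sumr.
      rewrite (bigD1 k) //= eqxx mulr1 big1 ?addr0 // => l lNk.
      by rewrite (negbTE lNk) mulr0.
    under eq_bigr do rewrite inner.
    transitivity (\sum_j' (j' == j)%:R * (b i j' k - e * r i j') -
        e * (\sum_j' b i j' k - e * t i)).
      rewrite mulrBr !mulr_sumr -!sumrB; apply: eq_bigr => l _.
      by rewrite mean_reflectionE -/e; ring.
    rewrite (bigD1 j) //= eqxx mul1r big1 ?addr0; last first.
      by move=> l lNj; rewrite (negbTE lNj) mul0r.
    have -> : \sum_j' b i j' k = r i k by apply: eq_bigr => l _; rewrite b_sym.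
    ring.
  have e0 : e != 0 by rewrite mulf_neq0 ?invr_eq0 // pnatr_eq0.
  move=> E; apply: (mulfI e0); apply/eqP; rewrite -subr_eq0; apply/eqP.
  transitivity ((b i j k - e * r i k - e * r i j + e * e * t i) -
     (b i j k - e * c j k)); first by ring.
  by rewrite E subrr.
have nr i j : C j = n%:R * r i j - t i.
  rewrite /C; under eq_bigr do rewrite (refl i).
  rewrite sumrB big_split /= !sumr_const card_ord -/(t i) /e.
  rewrite -(mulr_natl (r i j)) -(mulr_natl (_ * t i)).
  by field; rewrite n_neq0.
have sumC : \sum_j C j = 0.
  pose i := Ordinal n_gt0; under eq_bigr do rewrite (nr i).
  by rewrite sumrB sumr_const card_ord -mulr_sumr -/(t i) mulr_natl subrr.
have sumt : \sum_i t i = 0.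
  rewrite /t exchange_big -[RHS]sumC; apply: eq_bigr => j _.
  by rewrite exchange_big; apply: eq_bigr => k _; apply: eq_bigr => i _; rewrite b_sym.
have rS (s : 'S_n) i j : r (s i) (s j) = r i j.
  by rewrite /r (reindex_inj (@perm_inj _ s)); apply: eq_bigr => k _.
have cS (s : 'S_n) i j : c (s i) (s j) = c i j.
  by rewrite /c (reindex_inj (@perm_inj _ s)); apply: eq_bigr => k _.
have t0 : forall i, t i = 0.
  apply: constF sumt => s i; rewrite /t (reindex_inj (@perm_inj _ s)).
  by apply: eq_bigr => k _.
have C0 : forall i, C i = 0.
  apply: constF sumC => s i; rewrite /C (reindex_inj (@perm_inj _ s)).
  by apply: eq_bigr => k _.
have r0 i j : r i j = 0.
  by apply/eqP; have /eqP := nr i j; rewrite C0 t0 subr0 eq_sym mulf_eq0 (negbTE n_neq0).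
split=> // j k; rewrite -/(c j k).
by rewrite (refl j) !r0 t0 mulr0 addr0 subr0.
Qed.

(** Along one free index, an orbit takes a single value apart from entries already known to vanish,
    and its sum is zero. The orbits [iik] and [kii] come first, as they supply the exceptional
    entries of [ijk]. *)
Lemma equivariant_array_eq0 :
  (forall i, b i i i = 0) -> forall i j k, b i j k = 0.
Proof.
move=> b0; have [row0 sum0] := equivariant_sums0.
have biik i k : b i i k = 0.
  have [->|kNi] := eqVneq k i; first exact: b0.
  apply: (sum_two_valued_eq0 (F := fun k => b i i k)) (row0 i i) _ => l.
  have [->|lNi] := eqVneq l i; first by left.
  by right; rewrite -(bS (tperm k l) i i k) tpermL tpermD // eq_sym.
have bkii i k : b k i i = 0.
  have [->|kNi] := eqVneq k i; first exact: b0.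
  apply: (sum_two_valued_eq0 (F := fun k => b k i i)) (sum0 i i) _ => l.
  have [->|lNi] := eqVneq l i; first by left.
  by right; rewrite -(bS (tperm k l) k i i) tpermL tpermD // eq_sym.
move=> i j k.
have [->|jNi] := eqVneq j i; first exact: biik.
have [->|kNi] := eqVneq k i; first by rewrite b_sym.
have [->|kNj] := eqVneq k j; first exact: bkii.
apply: (sum_two_valued_eq0 (F := fun k => b i j k)) (row0 i j) _ => l.
have [->|lNi] := eqVneq l i; first by left; rewrite b_sym.
have [->|lNj] := eqVneq l j; first by left.
by right; rewrite -(bS (tperm k l) i j k) tpermL !tpermD // eq_sym.
Qed.

End Uniqueness.

End QuadraticArrays.

(** * The invariant field given by the centered square *)

Section MeanFreeSquare.
Variables (R : realFieldType) (n : nat).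

Definition centering : 'M[R]_n := 1%:M - const_mx n%:R^-1.

(* The coefficients of [x |-> C ((C x)^2)], where [C] is the centering and   *)
(* the square is taken entrywise.                                            *)
Definition centered_square (i j k : 'I_n) : R :=
  \sum_l centering i l * (centering l j * centering l k).

Lemma centered_square_sym : symmetric_array centered_square.
Proof. by move=> i j k; apply: eq_bigr => l _; rewrite (mulrC (centering l j)). Qed.

(** The hypothesis is [C ((C g x) ^ 2) = g C ((C x) ^ 2)] in coefficients; only exchanges of sums
    separate it from equivariance. *)
Lemma centered_square_equivariant g (b := centered_square) :
  (forall i j k,
     \sum_l centering i l * ((centering *m g) l j * (centering *m g) l k) =
     \sum_l (g *m centering) i l * (centering l j * centering l k)) ->
  equivariant_array g b.
Proof.
move=> gE i j k; transitivity
  (\sum_l centering i l * ((centering *m g) l j * (centering *m g) l k)).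
  under [RHS]eq_bigr => l _ do
    rewrite [(_ *m _) l j]mxE [(_ *m _) l k]mxE big_distrlr mulr_sumr.
  rewrite [RHS]exchange_big; apply: eq_bigr => j' _ /=.
  under [RHS]eq_bigr do rewrite mulr_sumr.
  rewrite [RHS]exchange_big; apply: eq_bigr => k' _ /=.
  rewrite mulr_suml; apply: eq_bigr => l _. ring.
rewrite gE; under eq_bigr => l _ do rewrite [(_ *m _) i l]mxE mulr_suml.
rewrite exchange_big; apply: eq_bigr => m _ /=.
by rewrite mulr_sumr; apply: eq_bigr => l _; ring.
Qed.

Lemma centered_square_perm (s : 'S_n) :
  equivariant_array (perm_mx s) centered_square.
Proof.
apply: centered_square_equivariant => i j k.
have CS l m : centering (s l) (s m) = centering l m.
  by rewrite !mxE (inj_eq perm_inj).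
have Cs l m : (centering *m perm_mx s) l (s m) = centering l m.
  have sE q : perm_mx s q (s m) = (q == m)%:R :> R by rewrite !mxE (inj_eq perm_inj).
  rewrite mxE (bigD1 m) //= big1 => [|q /negbTE qNm]; rewrite sE.
    by rewrite eqxx mulr1 addr0.
  by rewrite qNm mulr0.
rewrite [RHS](reindex_inj (@perm_inj _ s)); apply: eq_bigr => l _.
have -> : (perm_mx s *m centering) i (s l) = centering i l.
  by rewrite -row_permE mxE CS.
by rewrite -[j](permKV s) -[k](permKV s) !Cs !CS.
Qed.

Hypothesis n_ge3 : (3 <= n)%N.

Let n_gt0 : 0 < n%:R :> R. Proof. by rewrite ltr0n; case: n n_ge3. Qed.

(** With [P] the averaging projection the matrix is [1 - 2 P], with square
    [1 - 4 P + 4 P ^ 2 = 1]. *)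
Lemma mean_reflection_sqr :
  mean_reflection R n *m mean_reflection R n = 1%:M.
Proof.
apply/matrixP => i j; rewrite mxE.
under eq_bigr do rewrite !mean_reflectionE mulrBl mulrBr.
rewrite !sumrB mxE -mulr_sumr (bigD1 i) //= eqxx mul1r big1 => [|l lNi].
  rewrite addr0 -mulr_suml sumrB sumr_const card_ord.
  have sum1 k : \sum_l (l == k)%:R = 1 :> R.
    by rewrite (bigD1 k) //= eqxx big1 ?addr0 // => l /negbTE->.
  under eq_bigr do rewrite eq_sym.
  rewrite !sum1 -(mulr_natl (2%:R / n%:R)).
  by field; rewrite gt_eqF.
by rewrite eq_sym (negbTE lNi) mul0r.
Qed.

(** The centering kills constants on both sides, so it absorbs the reflection on either side and the
    criterion becomes an identity. *)
Lemma centered_square_refl :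
  equivariant_array (mean_reflection R n) centered_square.
Proof.
have sum1 (k : 'I_n) : \sum_(l < n) (l == k)%:R = 1 :> R.
  by rewrite (bigD1 k) //= eqxx big1 ?addr0 // => l /negbTE->.
have CJ i : \sum_l centering i l = 0.
  under eq_bigr do rewrite !mxE eq_sym.
  by rewrite sumrB sum1 sumr_const card_ord -(mulr_natl n%:R^-1) divff ?subrr ?gt_eqF.
have JC i : \sum_l centering l i = 0.
  by rewrite -[RHS](CJ i); apply: eq_bigr => l _; rewrite !mxE eq_sym.
apply: centered_square_equivariant => i j k.
have -> : centering *m mean_reflection R n = centering.
  rewrite /mean_reflection mulmxBr mulmx1 -[RHS]subr0; congr (_ - _).
  apply/matrixP => l m; rewrite mxE; under eq_bigr do rewrite [X in _ * X]mxE.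
  by rewrite -mulr_suml CJ mul0r mxE.
have -> // : mean_reflection R n *m centering = centering.
rewrite /mean_reflection mulmxBl mul1mx -[RHS]subr0; congr (_ - _).
apply/matrixP => l m; rewrite mxE; under eq_bigr do rewrite [X in X * _]mxE.
by rewrite -mulr_sumr JC mulr0 mxE.
Qed.

(** The entry equals [(n - 1) (n - 2) / n ^ 2], which would vanish for [n = 2]. *)
Lemma centered_square_neq0 i : centered_square i i i != 0.
Proof.
rewrite /centered_square (bigD1 i) //= !mxE eqxx.
under eq_bigr => l lNi do rewrite !mxE (eq_sym i) (negbTE lNi) !sub0r.
rewrite sumr_const cardC1 card_ord -subn1 -[_ *+ (_ - _)]mulr_natl.
rewrite natrB ?(leq_trans _ n_ge3) //.
set N : R := n%:R.
have N0 : N != 0 by rewrite gt_eqF.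
have N3 : 3%:R <= N by rewrite ler_nat.
rewrite -[true%:R]/(1 : R).
have -> : (1 - N^-1) * ((1 - N^-1) * (1 - N^-1)) +
    (N - 1) * (- N^-1 * (- N^-1 * - N^-1)) =
    (N - 1) * (N - 2%:R) / N ^+ 2 by field.
by rewrite !mulf_neq0 ?invr_eq0 ?expf_neq0 // gt_eqF //; lra.
Qed.

End MeanFreeSquare.

(** * Quadratic polynomials, their vector fields and denominators *)

Section QuadraticVectorFields.
Import mpoly.
Variables (R : numFieldType) (n : nat).
Implicit Types (c : 'I_n -> 'I_n -> R) (b : 'I_n -> 'I_n -> 'I_n -> R).
Implicit Types (g : 'M[R]_n) (p q D : {mpoly R[n]}) (r : ratfun R n).

Local Notation "p %:F" := (@FracField.tofrac {mpoly R[n]} p).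

Definition quad_poly c : {mpoly R[n]} := \sum_j \sum_k c j k *: ('X_j * 'X_k).

Definition quad_vfield b : vfield R n := \col_i (quad_poly (b i))%:F.

Lemma eq_quad_poly c c' : (forall j k, c j k = c' j k) -> quad_poly c = quad_poly c'.
Proof. by move=> E; apply: eq_bigr => j _; apply: eq_bigr => k _; rewrite E. Qed.

Lemma quad_poly_meval c (v : 'I_n -> R) :
  (quad_poly c).@[v] = \sum_j \sum_k c j k * (v j * v k).
Proof.
rewrite raddf_sum; apply: eq_bigr => j _; rewrite raddf_sum.
by apply: eq_bigr => k _; rewrite /= mevalZ mevalM !mevalXU.
Qed.

(** A polynomial determines only the symmetric part of an array, hence the two symmetry
    hypotheses. *)
Lemma quad_poly_inj c c' : (forall j k, c j k = c k j) ->
  (forall j k, c' j k = c' k j) -> quad_poly c = quad_poly c' ->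
  forall j k, c j k = c' j k.
Proof.
move=> cS cS' E j k; apply/eqP; rewrite -subr_eq0; apply/eqP; move: j k.
apply: qform_eq0 => [j k|v]; first by rewrite cS cS'.
have /eqP := congr1 (fun p => p.@[v]) E.
rewrite !quad_poly_meval -subr_eq0 -sumrB => /eqP {}E; rewrite -[RHS]E.
apply: eq_bigr => j _; rewrite -sumrB; apply: eq_bigr => k _.
by rewrite mulrBl.
Qed.

Lemma quad_poly_homog c : quad_poly c \is 2.-homog.
Proof.
apply: rpred_sum => j _; apply: rpred_sum => k _; apply: rpredZ.
by rewrite -mpolyXD dhomogX /= mdegD !mdeg1.
Qed.

Lemma homog2_quad_poly p : p \is 2.-homog ->
  exists2 c, (forall j k, c j k = c k j) & p = quad_poly c.
Proof.
move=> ph; suff [c ->] : exists c, p = quad_poly c.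
  exists (fun j k => (c j k + c k j) / 2%:R) => [j k|]; first by rewrite addrC.
  have E : quad_poly c = quad_poly (fun j k => c k j).
    rewrite /quad_poly exchange_big; apply: eq_bigr => j _.
    by apply: eq_bigr => k _; rewrite mulrC.
  have two : 2%:R != 0 :> R by rewrite pnatr_eq0.
  apply: (scalerI two); rewrite {1}scaler_nat mulr2n {2}E -big_split scaler_sumr.
  apply: eq_bigr => j _; rewrite -big_split scaler_sumr; apply: eq_bigr => k _.
  by rewrite /= -scalerDl scalerA [2%:R * _]mulrC divfK.
rewrite (mpolyE p) big_seq.
apply: (big_ind (fun q => exists c, q = quad_poly c)).
- exists (fun _ _ => 0); rewrite /quad_poly big1 // => j _.
  by rewrite big1 // => k _; rewrite scale0r.
- move=> _ _ [c ->] [c' ->]; exists (fun j k => c j k + c' j k).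
  rewrite -big_split; apply: eq_bigr => j _; rewrite -big_split.
  by apply: eq_bigr => k _; rewrite /= -scalerDl.
move=> m /(dhomogP _ _ _ ph) mE; set a := p@_m.
(* Removing a variable [i] from a monomial of degree two leaves degree one, that is, a single
   variable [k]. *)
have [i mi] : exists i, m i != 0%N.
  apply/existsP; apply: contra_eqT mE; rewrite negb_exists => /forallP m0.
  by rewrite /= mdegE big1 // => i _; apply/eqP; have := m0 i; rewrite negbK.
have mS : (m - U_(i) + U_(i))%MM = m by rewrite submK // lep1mP.
have /mdeg1P [k /eqP kE] : mdeg (m - U_(i))%MM == 1%N.
  by move: mE; rewrite /= -{1}mS mdegD mdeg1 addn1 => -[->].
exists (fun j l => a *+ ((j == k) && (l == i))).
rewrite /quad_poly (bigD1 k) //= (bigD1 i) //= !eqxx mulr1n.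
rewrite big1 => [|l /negbTE->]; last by rewrite andbF mulr0n scale0r.
rewrite big1 => [|l /negbTE->]; last first.
  by rewrite big1 // => j _; rewrite mulr0n scale0r.
by rewrite !addr0 -mpolyXD -kE mS.
Qed.

Lemma quad_poly_subst g c : poly_subst g (quad_poly c) =
  quad_poly (fun j k => \sum_j' \sum_k' c j' k' * (g j' j * g k' k)).
Proof.
transitivity (\sum_j' \sum_k' c j' k' *:
    ((\sum_j g j' j *: 'X_j) * (\sum_k g k' k *: 'X_k)) : {mpoly R[n]}).
  rewrite /poly_subst raddf_sum; apply: eq_bigr => j _.
  rewrite raddf_sum; apply: eq_bigr => k _.
  rewrite /= comp_mpolyZ rmorphM /= !comp_mpolyXU -!tnth_nth.
  by rewrite !tnth_mktuple.
transitivity (\sum_j' \sum_k' \sum_j \sum_k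
    (c j' k' * (g j' j * g k' k)) *: ('X_j * 'X_k) : {mpoly R[n]}).
  apply: eq_bigr => j' _; apply: eq_bigr => k' _.
  rewrite big_distrlr scaler_sumr; apply: eq_bigr => j _.
  rewrite scaler_sumr; apply: eq_bigr => k _.
  by rewrite /= -scalerAl -scalerAr !scalerA !mulrA.
under eq_bigr do rewrite exchange_big; rewrite exchange_big.
apply: eq_bigr => j _ /=.
under eq_bigr do rewrite exchange_big; rewrite exchange_big.
apply: eq_bigr => k _ /=.
by rewrite scaler_suml; apply: eq_bigr => j' _; rewrite scaler_suml.
Qed.

Lemma rat_subst_tofrac g p : g \in unitmx ->
  rat_subst g p%:F = (poly_subst g p)%:F.
Proof.
move=> gU; rewrite -[p%:F]divr1 -(rmorph1 (@FracField.tofrac {mpoly R[n]})).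
rewrite rat_substE ?oner_neq0 // [poly_subst g 1]comp_mpoly1.
by rewrite rmorph1 divr1.
Qed.

(** Multiplication by [g] clears the inverse and leaves [Q (g x) = g Q x], an equality of quadratic
    polynomials; symmetry of [b] allows comparing coefficients. *)
Lemma quad_vfield_invariant g b : g \in unitmx -> symmetric_array b ->
  vfield_conj g (quad_vfield b) = quad_vfield b <-> equivariant_array g b.
Proof.
move=> gU bS; rewrite /vfield_conj.
pose f : {rmorphism R -> ratfun R n} := (@FracField.tofrac {mpoly R[n]}) \o (@mpolyC n R).
have -> : map_mx (fun a => (mpolyC n a)%:F) (invmx g) = map_mx f (invmx g) by [].
have -> : map_mx (rat_subst g) (quad_vfield b) =
    \col_i (quad_poly (fun j k => \sum_j' \sum_k' b i j' k' * (g j' j * g k' k)))%:F.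
  by apply/matrixP => i z; rewrite !mxE rat_subst_tofrac // quad_poly_subst.
have gQ : map_mx f g *m quad_vfield b =
    \col_i (quad_poly (fun j k => \sum_l g i l * b l j k))%:F.
  apply/matrixP => i z; rewrite !mxE.
  transitivity ((\sum_l g i l *: quad_poly (b l))%:F).
    rewrite raddf_sum; apply: eq_bigr => l _.
    by rewrite !mxE /= -mul_mpolyC rmorphM.
  congr (_ %:F); under eq_bigr do rewrite scaler_sumr.
  rewrite exchange_big; apply: eq_bigr => j _ /=.
  under eq_bigr do rewrite scaler_sumr.
  rewrite exchange_big; apply: eq_bigr => k _ /=.
  by rewrite scaler_suml; apply: eq_bigr => l _; rewrite scalerA.
have fgU : map_mx f g \in unitmx by rewrite map_unitmx.
have fV : map_mx f (invmx g) = invmx (map_mx f g) by rewrite map_invmx.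
split=> [E i j k|E].
  have := congr1 (mulmx (map_mx f g)) E; rewrite fV mulKVmx // gQ.
  move/colP/(_ i); rewrite !mxE => /eqP; rewrite tofrac_eq => /eqP E'.
  apply: (quad_poly_inj _ _ E') => j' k'.
    rewrite exchange_big; apply: eq_bigr => m _; apply: eq_bigr => l _.
    by rewrite bS (mulrC (g l _)).
  by apply: eq_bigr => l _; rewrite bS.
apply: (canLR (mulKVmx _)); rewrite fV ?invmxK ?unitmx_inv // gQ.
by apply/colP => i; rewrite !mxE; congr (_ %:F); apply: eq_quad_poly => j k; rewrite E.
Qed.

Lemma quad_vfield_homog2 b : vfield_homog2 (quad_vfield b).
Proof.
move=> i; exists 0%N, (quad_poly (b i)), 1; split.
- exact: quad_poly_homog.
- exact: dhomog1.
- exact: oner_neq0.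
by rewrite mxE rmorph1 divr1.
Qed.

(** The value may come from any fraction [p / q] with [q] nonzero at [x]; cross-multiplication shows
    [p] to be [q] times the quadratic polynomial. *)
Lemma quad_vfield_value b (x v : 'cV[R]_n) : vfield_value (quad_vfield b) x v ->
  forall i, v i 0 = \sum_j \sum_k b i j k * (x j 0 * x k 0).
Proof.
move=> E i; have [p [q [pqE qx ->]]] := E i.
rewrite -(quad_poly_meval (b i) (fun i => x i 0)).
have q0 : q != 0 by apply: contra_neq qx => ->; rewrite meval0.
have qF : q%:F != 0 by rewrite tofrac_eq0.
move: pqE; rewrite mxE => /(canLR (divfK qF)).
rewrite -rmorphM => /eqP; rewrite tofrac_eq => /eqP <-.
by rewrite mevalM mulfK.
Qed.

(** The product of the denominators of the representatives is a common denominator, so the set of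
    degrees is nonempty and has a minimum. *)
Lemma denom_degree_exists (Q : vfield R n) : exists d, denom_degree Q d.
Proof.
have [D [D0 DQ]] : exists D, common_denom Q D.
  exists (\prod_i \d_(generic_quotient.repr (Q i 0))); split.
    by apply/prodf_neq0 => i _; exact: denom_ratioP.
  move=> i; rewrite (bigD1 i) //=; set q := \prod_(_ | _) _.
  exists (\n_(generic_quotient.repr (Q i 0)) * q).
  have q0 : q%:F != 0.
    by rewrite tofrac_eq0; apply/prodf_neq0 => l _; exact: denom_ratioP.
  by rewrite !rmorphM /= -mulf_div divff // mulr1 -ratfun_repr.
pose P d := boolp.asbool (exists2 E, common_denom Q E & (msize E).-1 = d).
have exP : exists d, P d by exists (msize D).-1; apply/boolp.asboolP; exists D.
case: (ex_minnP exP) => d /boolp.asboolP Pd dmin; exists d; split=> // E cE.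
by apply: dmin; apply/boolp.asboolP; exists E.
Qed.

(** A constant denominator makes each component a polynomial [p'] with [p' * q1 = p1], where [q1]
    and [p1] are homogeneous of degrees [d] and [d + 2]. Comparing graded parts in a domain leaves
    only degree two in [p']. *)
Lemma denom_degree0_quad (Q : vfield R n) : vfield_homog2 Q ->
  denom_degree Q 0 -> exists2 b, symmetric_array b & Q = quad_vfield b.
Proof.
move=> Qh [[D [D0 DQ] sD] _].
have /msize_poly1P [a a0 DE] : msize D == 1%N.
  by move: D0; rewrite -msize_poly_eq0; case: (msize D) sD => // k /= ->.
have poly i : exists2 c, (forall j k, c j k = c k j) & Q i 0 = (quad_poly c)%:F.
  have [p pE] := DQ i; have [d [p1 [q1 [p1h q1h q10 QE]]]] := Qh i.
  pose p' := a^-1 *: p.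
  have {}pE : Q i 0 = p'%:F.
    rewrite pE DE /p' -mul_mpolyC rmorphM /= mulrC; congr (_ * _).
    have aF : (a%:MP_[n])%:F != 0 by rewrite tofrac_eq0 mpolyC_eq0.
    by apply: (mulfI aF); rewrite divff // -rmorphM -mpolyCM divff.
  have pq : p' * q1 = p1.
    apply/eqP; rewrite -tofrac_eq rmorphM /= -pE QE divfK //.
    by rewrite tofrac_eq0.
  have pi0 e : e != 2%N -> pihomog mdeg e p' = 0.
    move=> e2; apply: (mulIf q10); rewrite mul0r.
    (* The part of degree [e + d] is zero on the side of [p1]; on the other side it is the part of
       [p'] of degree [e], times [q1]. *)
    have : pihomog mdeg (e + d)%N (p' * q1) = 0.
      by rewrite pq (pihomog_ne0 _ p1h) // -addn2 addnC eqn_add2r eq_sym.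
    rewrite {1}(pihomog_partitionE (leqnn (mmeasure mdeg p'))) mulr_suml raddf_sum.
    have [le|lt] := ltnP e (mmeasure mdeg p').
      rewrite (bigD1 (Ordinal le)) //= big1 ?addr0 => [|f /negbTE fN].
        by rewrite pihomog_dE // dhomogM // pihomogP.
      rewrite (@pihomog_ne0 _ _ _ (f + d)%N) //; last by rewrite dhomogM // pihomogP.
      by rewrite eqn_add2r; apply: contraFN fN => /eqP fe; apply/eqP/val_inj.
    have -> // : pihomog mdeg e p' = 0; last by rewrite mul0r.
    rewrite pihomogE big_seq_cond big1 // => m /andP [mp /eqP me].
    by have := mmeasure_mnm_lt mdeg mp; rewrite me ltnNge lt.
  have ph : p' \is 2.-homog.
    rewrite (pihomog_partitionE (leqnn (mmeasure mdeg p'))).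
    apply: rpred_sum => f _; have [->|f2] := eqVneq (f : nat) 2%N.
      exact: pihomogP.
    by rewrite pi0 // rpred0.
  have [c cS cE] := homog2_quad_poly ph.
  by exists c; rewrite // pE cE.
have [b bP] := boolp.choice (fun i => let: ex_intro2 c cS cE := poly i in
  ex_intro (fun c => (forall j k, c j k = c k j) /\ Q i 0 = (quad_poly c)%:F) c
    (conj cS cE)).
exists b => [i j k|]; first by have [bS _] := bP i; exact: bS.
by apply/colP => i; rewrite mxE; have [] := bP i.
Qed.

Lemma quad_vfield_denom_degree b : denom_degree (quad_vfield b) 0.
Proof.
split=> //; exists 1; last by rewrite msize1.
split; first exact: oner_neq0.
by move=> i; exists (quad_poly (b i)); rewrite mxE rmorph1 divr1.
Qed.

End QuadraticVectorFields.

(** * Closure properties of equivariance, and uniqueness up to a scalar *)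

Section EquivariantArrays.
Variables (R : numFieldType) (n : nat).
Implicit Types (b : 'I_n -> 'I_n -> 'I_n -> R) (g h : 'M[R]_n).

Lemma equivariant_array1 b : equivariant_array 1%:M b.
Proof.
move=> i j k; rewrite (bigD1 j) //= (bigD1 k) //= [RHS](bigD1 i) //= !mxE !eqxx.
rewrite !mulr1 mul1r [X in _ + X + _]big1 => [|l /negbTE lNk]; last first.
  by rewrite !mxE lNk !mulr0.
rewrite [X in _ + X = _]big1 => [|l /negbTE lNj]; last first.
  by rewrite big1 // => m _; rewrite !mxE lNj mul0r mulr0.
rewrite [X in _ = _ + X]big1 ?addr0 // => l /negbTE lNi.
by rewrite mxE eq_sym lNi mul0r.
Qed.

(** For the field [B] of [b], [B (g h x) = g B (h x) = g h B x]. *)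
Lemma equivariant_arrayM g h b : equivariant_array g b ->
  equivariant_array h b -> equivariant_array (g *m h) b.
Proof.
move=> gb hb i j k; transitivity
  (\sum_p \sum_q (\sum_j' \sum_k' b i j' k' * (g j' p * g k' q)) * (h p j * h q k)).
  transitivity (\sum_j' \sum_k' \sum_p \sum_q
      b i j' k' * (g j' p * g k' q) * (h p j * h q k)).
    apply: eq_bigr => j' _; apply: eq_bigr => k' _.
    rewrite !mxE big_distrlr mulr_sumr; apply: eq_bigr => p _.
    by rewrite mulr_sumr; apply: eq_bigr => q _ /=; ring.
  under eq_bigr do rewrite exchange_big; rewrite exchange_big.
  apply: eq_bigr => p _ /=.
  under eq_bigr do rewrite exchange_big; rewrite exchange_big.
  apply: eq_bigr => q _ /=.
  by rewrite mulr_suml; apply: eq_bigr => j' _; rewrite mulr_suml.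
transitivity (\sum_l g i l * \sum_p \sum_q b l p q * (h p j * h q k)).
  under [RHS]eq_bigr do rewrite mulr_sumr.
  rewrite [RHS]exchange_big; apply: eq_bigr => p _ /=.
  under [RHS]eq_bigr do rewrite mulr_sumr.
  rewrite [RHS]exchange_big; apply: eq_bigr => q _ /=.
  by rewrite gb mulr_suml; apply: eq_bigr => l _; rewrite -mulrA.
under eq_bigr do rewrite hb mulr_sumr.
rewrite exchange_big; apply: eq_bigr => m _ /=.
by rewrite mxE mulr_suml; apply: eq_bigr => l _; rewrite mulrA.
Qed.

Lemma equivariant_array_subZ g b b' (c : R) : equivariant_array g b ->
  equivariant_array g b' ->
  equivariant_array g (fun i j k => b' i j k - c * b i j k).
Proof.
move=> gb gb' i j k.
under [RHS]eq_bigr do rewrite mulrBr mulrCA.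
rewrite sumrB -mulr_sumr -gb -gb' mulr_sumr -sumrB; apply: eq_bigr => j' _.
rewrite mulr_sumr -sumrB; apply: eq_bigr => k' _; ring.
Qed.

(** One diagonal entry fixes the scalar; transpositions carry it to the whole diagonal, where
    [b' - c b] therefore vanishes. *)
Lemma equivariant_array_unique b b' (i0 : 'I_n) :
  symmetric_array b -> symmetric_array b' ->
  (forall s : 'S_n, equivariant_array (perm_mx s) b) ->
  (forall s : 'S_n, equivariant_array (perm_mx s) b') ->
  equivariant_array (mean_reflection R n) b ->
  equivariant_array (mean_reflection R n) b' ->
  b i0 i0 i0 != 0 -> exists c, forall i j k, b' i j k = c * b i j k.
Proof.
move=> bS b'_sym bs b'_perm bz b'_refl b0; exists (b' i0 i0 i0 / b i0 i0 i0) => i j k.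
set c := _ / _; apply/eqP; rewrite -subr_eq0; apply/eqP; move: i j k.
apply: equivariant_array_eq0.
- exact: leq_ltn_trans (ltn_ord i0).
- by move=> i j k; rewrite bS (b'_sym i).
- by move=> s; apply: equivariant_array_subZ.
- exact: equivariant_array_subZ.
move=> i; have <- : tperm i0 i i0 = i by exact: tpermL.
rewrite (equivariant_perm_mx (bs _)) (equivariant_perm_mx (b'_perm _)).
by rewrite divfK // subrr.
Qed.

Lemma quad_vfieldZ b (c : R) :
  vfield_scale c (quad_vfield b) = quad_vfield (fun i j k => c * b i j k).
Proof.
apply/colP => i; rewrite /vfield_scale !mxE -rmorphM /= mpoly.mul_mpolyC.
congr FracField.tofrac; rewrite scaler_sumr; apply: eq_bigr => j _.
by rewrite scaler_sumr; apply: eq_bigr => k _; rewrite scalerA.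
Qed.

Lemma quad_vfield_eq0 b : symmetric_array b -> quad_vfield b = 0 ->
  forall i j k, b i j k = 0.
Proof.
move=> bS /colP b0 i; apply: (quad_poly_inj (c' := fun _ _ => 0)) => //.
have /eqP := b0 i; rewrite !mxE tofrac_eq0 => /eqP ->.
rewrite /quad_poly big1 // => j _; rewrite big1 // => k _; exact: scale0r.
Qed.

End EquivariantArrays.

From mathcomp Require Import all_classical all_reals all_analysis.
Import numFieldNormedType.Exports.

(** * Power series with geometrically bounded coefficients *)

Section GeometricallyBoundedSequences.
Local Open Scope classical_set_scope.
Variable R : realType.
Implicit Types (f g : R^nat) (x L M h : R).

(** Absorbs a linear factor into a slightly larger geometric rate: [1 + k h <= (1 + h) ^ k],
    multiplied by [1 + 1 / h]. *)
Lemma bernoulli h k : 0 < h -> k.+1%:R <= (1 + h^-1) * (1 + h) ^+ k.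
Proof.
move=> h0; have hV : 0 < h^-1 by rewrite invr_gt0.
have B : 1 + k%:R * h <= (1 + h) ^+ k.
  elim: k => [|k IHk]; first by rewrite mul0r addr0.
  rewrite exprS; apply: le_trans (ler_wpM2l _ IHk); last by lra.
  rewrite -natr1; have : 0 <= k%:R * (h * h) by rewrite !mulr_ge0 // ltW.
  lra.
apply: le_trans (ler_wpM2l _ B); last by lra.
have -> : (1 + h^-1) * (1 + k%:R * h) = 1 + k%:R * h + h^-1 + k%:R.
  by field; rewrite gt_eqF.
have : 0 <= k%:R * h by rewrite mulr_ge0 // ltW.
by rewrite -natr1; lra.
Qed.

Lemma cvg_pseries_geom f M L x : (forall k, `|f k| <= M * L ^+ k) ->
  0 <= L -> L * `|x| < 1 -> cvgn (pseries f x).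
Proof.
move=> fM L0 Lx; have M0 : 0 <= M.
  by have := le_trans (normr_ge0 _) (fM 0%N); rewrite mulr1.
apply: normed_cvg; apply: (@series_le_cvg _ _ (geometric M (L * `|x|))) => [k|k|k|].
- exact: normr_ge0.
- by rewrite /= mulr_ge0 // exprn_ge0 // mulr_ge0.
- by rewrite /= normrM normrX exprMn mulrA ler_wpM2r // exprn_ge0.
by apply: is_cvg_geometric_series; rewrite ger0_norm // mulr_ge0.
Qed.

Lemma pseries_diffs_geom f M L L' : (forall k, `|f k| <= M * L ^+ k) ->
  0 < L -> L < L' ->
  exists M', forall k, `|pseries_diffs f k| <= M' * L' ^+ k.
Proof.
move=> fM L0 LL'; have M0 : 0 <= M.
  by have := le_trans (normr_ge0 _) (fM 0%N); rewrite mulr1.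
pose h := L' / L - 1.
have h0 : 0 < h by rewrite subr_gt0 ltr_pdivlMr // mul1r.
exists (M * L * (1 + h^-1)) => k.
rewrite /pseries_diffs normrM normr_nat.
apply: le_trans (ler_pM _ _ (bernoulli k h0) (fM k.+1)) _ => //.
have -> : 1 + h = L' / L by rewrite /h addrC subrK.
rewrite exprMn exprVn exprS.
rewrite le_eqVlt; apply/orP; left; apply/eqP; field.
by rewrite expf_neq0 gt_eqF.
Qed.

(** Termwise differentiation asks for convergence of the series and its first two derived series at
    a point beyond [|x|]. *)
Lemma is_derive_pseries_geom f M L x : (forall k, `|f k| <= M * L ^+ k) ->
  0 <= L -> L * `|x| < 1 ->
  is_derive x 1 (fun x => limn (pseries f x)) (limn (pseries (pseries_diffs f) x)).
Proof.
move=> fM L0 Lx; have M0 : 0 <= M.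
  by have := le_trans (normr_ge0 _) (fM 0%N); rewrite mulr1.
(* [K] exceeds [|x|] while keeping [L * K < 1]; dividing by [L + 1] covers [L = 0]. *)
pose K := `|x| + (1 - L * `|x|) / (2 * (L + 1)).
have K_gt : `|x| < K.
  by rewrite ltrDl divr_gt0 ?mulr_gt0 //; lra.
have K0 : 0 < K := le_lt_trans (normr_ge0 _) K_gt.
have LK : L * K < 1.
  have -> : L * K = L * `|x| + (1 - L * `|x|) * (L / (2 * (L + 1))).
    by rewrite /K; field; rewrite gt_eqF //; lra.
  have : L / (2 * (L + 1)) < 1 by rewrite ltr_pdivrMr; lra.
  by rewrite -(ltr_pM2l (x := 1 - L * `|x|)); lra.
(* A quarter of the gap leaves room for three increments: the rates [L + d] (positive even if
   [L = 0]), [L + 2 d] and [L + 3 d] stay below [1 / K]. *)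
pose d := (K^-1 - L) / 4.
have LKV : L < K^-1 by rewrite -[K^-1]mul1r ltr_pdivlMr.
have d0 : 0 < d by rewrite /d; lra.
have f0 k : `|f k| <= M * (L + d) ^+ k.
  by apply: le_trans (fM k) _; rewrite ler_wpM2l // lerXn2r ?nnegrE //; lra.
have Ld : 0 < L + d by lra.
have Ld1 : L + d < L + d + d by lra.
have Ld2 : L + d + d < L + d + d + d by lra.
have [M1 f1] := pseries_diffs_geom f0 Ld Ld1.
have [M2 f2] := pseries_diffs_geom f1 (lt_trans Ld Ld1) Ld2.
have cvgK a : 0 <= a -> a < K^-1 -> a * `|K| < 1.
  by move=> a0 aK; rewrite gtr0_norm // -(ltr_pdivlMr _ _ K0) div1r.
apply: (@pseries_snd_diffs _ _ K).
- by apply: cvg_pseries_geom f0 _ _; rewrite ?cvgK // /d; lra.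
- by apply: cvg_pseries_geom f1 _ _; rewrite ?cvgK // /d; lra.
- by apply: cvg_pseries_geom f2 _ _; rewrite ?cvgK // /d; lra.
by rewrite (gtr0_norm K0).
Qed.

Definition cauchy_product f g : R^nat :=
  fun k => \sum_(i < k.+1) f i * g (k - i)%N.

(** Both sides sum [f i * g j] over [i + j < N]. *)
Lemma series_cauchy_product f g N : series (cauchy_product f g) N =
  \sum_(i < N) f i * series g (N - i)%N.
Proof.
have seriesS (u : R^nat) m : series u m.+1 = series u m + u m.
  by rewrite /series /= big_nat_recr.
elim: N => [|N IHN]; first by rewrite /series /= big_nil big_ord0.
rewrite seriesS IHN [RHS]big_ord_recr /= subSnn seriesS.
rewrite [series g 0]/series /= big_nil add0r /cauchy_product big_ord_recr /=.
rewrite subnn addrA -big_split /=; congr (_ + _).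
apply: eq_bigr => i _; rewrite -mulrDr; congr (_ * _).
by rewrite subSn 1?ltnW // seriesS.
Qed.

(** The product of the partial sums exceeds the partial sum of the Cauchy product by the terms with
    [i, j < N <= i + j]: at most [N ^ 2] terms, each bounded by [M ^ 2 r ^ N]. *)
Lemma cvg_series_cauchy_product f g M r (F G : R) :
  (forall k, `|f k| <= M * r ^+ k) -> (forall k, `|g k| <= M * r ^+ k) ->
  0 <= r < 1 -> series f @ \oo --> F -> series g @ \oo --> G ->
  series (cauchy_product f g) @ \oo --> F * G.
Proof.
move=> fM gM /andP[r0 r1] cF cG; have M0 : 0 <= M.
  by have := le_trans (normr_ge0 _) (fM 0%N); rewrite mulr1.
have E N : `|series f N * series g N - series (cauchy_product f g) N| <=
    M * M * (N%:R * N%:R * r ^+ N).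
  rewrite series_cauchy_product {1}/series /= big_mkord mulr_suml -sumrB.
  apply: le_trans (ler_norm_sum _ _ _) _.
  apply: (@le_trans _ _ (\sum_(i < N) M * M * (N%:R * r ^+ N))); last first.
    by rewrite sumr_const card_ord -[_ *+ N]mulr_natl; lra.
  apply: ler_sum => i _; rewrite -mulrBr normrM.
  rewrite /series /= (big_cat_nat (n := N - i)) ?leq_subr //= addrAC subrr add0r.
  have -> : M * M * (N%:R * r ^+ N) = M * r ^+ i * (N%:R * (M * r ^+ (N - i))).
    have -> : r ^+ N = r ^+ i * r ^+ (N - i) by rewrite -exprD subnKC // ltnW.
    ring.
  apply: ler_pM => //.
  apply: le_trans (ler_norm_sum _ _ _) _.
  apply: (@le_trans _ _ (\sum_(N - i <= j < N) M * r ^+ (N - i))).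
    apply: ler_sum_nat => j /andP[jl _]; apply: le_trans (gM j) _.
    by rewrite ler_wpM2l // ler_wiXn2l // ltW.
  rewrite sumr_const_nat -[_ *+ (N - _)]mulr_natl ler_wpM2r ?ler_nat ?leq_subr //.
  by rewrite mulr_ge0 // exprn_ge0.
(* This [h] gives [q <= r + 3 h r = r + r (1 - r) / 2 < 1]; the factor [N ^ 2] costs two factors
   [1 + h] in the rate. *)
pose h := (1 - r) / 6.
have h0 : 0 < h by rewrite /h; lra.
pose q := (1 + h) ^+ 2 * r.
have q0 : 0 <= q by rewrite mulr_ge0 // exprn_ge0 //; lra.
have q1 : q < 1.
  have hr : 0 <= h * r by rewrite mulr_ge0 // ltW.
  have hhr : h * (h * r) <= h * r by rewrite ler_piMl // /h; lra.
  have : r * r < 1 by rewrite mulr_ilt1.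
  have -> : q = r + 2 * (h * r) + h * (h * r) by rewrite /q; ring.
  have : h * r = (r - r * r) / 6 by rewrite /h; ring.
  have : 0 <= (1 - r) * (1 - r) by rewrite sqr_ge0.
  nra.
pose C := M * M * (1 + h^-1) ^+ 2.
have E' N : `|series f N * series g N - series (cauchy_product f g) N| <= C * q ^+ N.
  apply: le_trans (E N) _; rewrite /C -[leRHS]mulrA ler_wpM2l ?mulr_ge0 //.
  have -> : (1 + h^-1) ^+ 2 * q ^+ N =
      ((1 + h^-1) * (1 + h) ^+ N) * ((1 + h^-1) * (1 + h) ^+ N) * r ^+ N.
    by rewrite /q exprMn -exprM mulnC exprM; ring.
  rewrite ler_wpM2r ?exprn_ge0 //.
  have N1 : N%:R <= (1 + h^-1) * (1 + h) ^+ N.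
    by apply: le_trans (bernoulli N h0); rewrite ler_nat.
  by apply: ler_pM.
have D0 : (fun N => series f N * series g N - series (cauchy_product f g) N)
    @ \oo --> (0 : R).
  apply/norm_cvg0P; apply: (@squeeze_cvgr _ _ _ _ (cst 0) (geometric C q)).
  - by apply: nearW => N; rewrite normr_ge0 /= E'.
  - exact: cvg_cst.
  - by apply: cvg_geometric; rewrite ger0_norm.
have -> : series (cauchy_product f g) = (fun N => series f N * series g N -
    (series f N * series g N - series (cauchy_product f g) N)).
  by apply/funext => N; rewrite subKr.
rewrite -[F * G]subr0; apply: cvgB => //; exact: cvgM.
Qed.

Lemma pseries_cauchy_product f g M L x :
  (forall k, `|f k| <= M * L ^+ k) -> (forall k, `|g k| <= M * L ^+ k) ->
  0 <= L -> L * `|x| < 1 ->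
  pseries (cauchy_product f g) x @ \oo --> limn (pseries f x) * limn (pseries g x).
Proof.
move=> fM gM L0 Lx.
have -> : pseries (cauchy_product f g) x =
    series (cauchy_product (fun k => f k * x ^+ k) (fun k => g k * x ^+ k)).
  apply/funext => N; apply: eq_bigr => k _; rewrite /= /cauchy_product mulr_suml.
  apply: eq_bigr => i _.
  have -> : x ^+ k = x ^+ i * x ^+ (k - i) by rewrite -exprD subnKC // -ltnS.
  ring.
have bound a k : (forall k, `|a k| <= M * L ^+ k) ->
    `|a k * x ^+ k| <= M * (L * `|x|) ^+ k.
  by move=> aM; rewrite normrM normrX exprMn mulrA ler_wpM2r // exprn_ge0.
apply: (@cvg_series_cauchy_product _ _ M (L * `|x|)).
- by move=> k; exact: bound.
- by move=> k; exact: bound.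
- by rewrite mulr_ge0.
- exact: (cvg_pseries_geom fM).
- exact: (cvg_pseries_geom gM).
Qed.

End GeometricallyBoundedSequences.

(** * Gronwall's inequality and uniqueness for quadratic differential equations *)

Section QuadraticOde.
Local Open Scope classical_set_scope.
Variables (R : realType) (n : nat).

(** [E t * exp (- K t)] is nonincreasing, nonnegative and starts at zero. *)
Lemma gronwall_eq0 (E dE : R -> R) (K : R) :
  (forall t : R, 0 <= t <= 1 -> is_derive t 1 E (dE t)) ->
  (forall t, 0 <= t <= 1 -> dE t <= K * E t) ->
  (forall t, 0 <= E t) -> E 0 = 0 -> E 1 = 0.
Proof.
move=> ED EK E0 E00; pose f t := E t * expR (- K * t).
have fD (t : R) : 0 <= t <= 1 ->
    is_derive t 1 f ((dE t - K * E t) * expR (- K * t)).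
  move=> t01; have := ED t t01 => ?.
  have ? : is_derive t 1 (fun t : R => expR (- K * t)) (expR (- K * t) * - K).
    have D1 : is_derive t 1 (fun s : R => - K * s) (- K).
      apply: (is_derive_eq (is_deriveZ (- K) (is_derive_id t 1))).
      by rewrite /GRing.scale /= mulr1.
    exact: (@is_derive1_comp _ expR (fun s => - K * s) _ _ _ (is_derive_expR _) D1).
  apply: is_derive_eq; rewrite /GRing.scale /=; ring.
have fd : {in `[0, 1]%R, forall x : R, derivable f x 1}.
  by move=> x; rewrite in_itv /= => /fD [].
have f01 : f 1 <= f 0.
  apply: (@ler0_derive1_nincr _ f 0 1) => // [x|x|].
  - by move=> /subset_itv_oo_cc /fd.
  - move=> /subset_itv_oo_cc; rewrite in_itv /= => x01.
    have [_ fx] := fD x x01; rewrite derive1E fx mulr_le0_ge0 ?expR_ge0 //.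
    by rewrite subr_le0 EK.
  - exact: derivable_within_continuous.
apply/eqP; rewrite eq_le E0 andbT.
move: f01; rewrite /f E00 mul0r mulr1 pmulr_lle0 //; exact: expR_gt0.
Qed.

Variable b : 'I_n -> 'I_n -> 'I_n -> R.

Definition quad_eval (x : 'I_n -> R) i := \sum_j \sum_k b i j k * (x j * x k).

Lemma bounded_on01 (f df : R -> R) :
  (forall t : R, 0 <= t <= 1 -> is_derive t 1 f (df t)) ->
  exists M, forall t, 0 <= t <= 1 -> `|f t| <= M.
Proof.
move=> fD; have fc : {within `[0, 1], continuous f}.
  by apply: derivable_within_continuous => x; rewrite in_itv /= => /fD [].
have [c _ cM] := EVT_max ler01 fc; have [d _ dm] := EVT_min ler01 fc.
exists (`|f c| + `|f d|) => t t01; rewrite ler_norml.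
have tI : t \in `[0, 1]%R by rewrite in_itv.
have := cM t tI; have := dm t tI.
have := ler_norm (f c); have := lerNnormlW (lexx `|f d|).
have := normr_ge0 (f c); have := normr_ge0 (f d); lra.
Qed.

(** The difference solves a linear system with bounded coefficients, so Gronwall applies to its
    squared length. The factor [a] rescales time: spans of any length and sign fit the unit
    interval. *)
Lemma quad_ode_unique (a : R) (u v : 'I_n -> R -> R) :
  (forall i (t : R), 0 <= t <= 1 -> is_derive t 1 (u i) (a * quad_eval (u^~ t) i)) ->
  (forall i (t : R), 0 <= t <= 1 -> is_derive t 1 (v i) (a * quad_eval (v^~ t) i)) ->
  (forall i, u i 0 = v i 0) -> forall i, u i 1 = v i 1.
Proof.
move=> uD vD uv0.
have [Mu uM] := choice (fun i => bounded_on01 (uD i)).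
have [Mv vM] := choice (fun i => bounded_on01 (vD i)).
pose d i t := u i t - v i t.
pose E t := \sum_i d i t ^+ 2.
(* The matrix of the linear system, from [u_j u_k - v_j v_k = u_j d_k + v_k d_j]. *)
pose c i j t := a * \sum_k (b i k j * u k t + b i j k * v k t).
pose C i j := `|a| * \sum_k (`|b i k j| * Mu k + `|b i j k| * Mv k).
have cC i j t : 0 <= t <= 1 -> `|c i j t| <= C i j.
  move=> t01; rewrite normrM ler_wpM2l //.
  apply: le_trans (ler_norm_sum _ _ _) _; apply: ler_sum => k _.
  apply: le_trans (ler_normD _ _) _; rewrite !normrM.
  by apply: lerD; apply: ler_wpM2l; rewrite ?uM ?vM.
have dE i t : a * quad_eval (u^~ t) i - a * quad_eval (v^~ t) i =
    \sum_j c i j t * d j t.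
  transitivity (a * (\sum_j \sum_k b i k j * u k t * d j t +
                     \sum_j \sum_k b i j k * v k t * d j t)).
    rewrite -mulrBr; congr (_ * _).
    rewrite [X in _ = X + _]exchange_big -!big_split -sumrB.
    apply: eq_bigr => j _; rewrite -!big_split -sumrB.
    by apply: eq_bigr => k _; rewrite /d /=; ring.
  rewrite -big_split mulr_sumr; apply: eq_bigr => j _.
  rewrite /c -mulrA; congr (_ * _).
  by rewrite mulr_suml -big_split; apply: eq_bigr => k _; rewrite mulrDl.
(* Since [|d i t * d j t| <= E t], this constant bounds the growth rate of [E]. *)
pose K := \sum_i \sum_j 2 * C i j.
have C0 i j : 0 <= C i j.
  by apply: le_trans (normr_ge0 (c i j 0)) (cC i j 0 _); rewrite lexx ler01.
suff E1 : E 1 = 0.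
  move=> i; apply/eqP; rewrite -subr_eq0 -sqrf_eq0; apply/eqP.
  apply: le_anti; rewrite sqr_ge0 andbT -[leRHS]E1 /E (bigD1 i) //=.
  by rewrite lerDl sumr_ge0 // => j _; rewrite sqr_ge0.
apply: (@gronwall_eq0 E (fun t => \sum_i 2 * d i t * (\sum_j c i j t * d j t)) K).
- move=> t t01.
  have EE : E = \sum_i (fun t => d i t ^+ 2) by apply/funext => s; rewrite fct_sumE.
  rewrite EE; apply: is_derive_sum => i.
  have ? := uD i t t01; have ? := vD i t t01.
  have ? : is_derive t 1 (d i) (\sum_j c i j t * d j t) by apply: is_derive_eq.
  by apply: is_derive_eq; rewrite /GRing.scale /=; ring.
- move=> t t01; rewrite /K mulr_suml; apply: ler_sum => i _.
  rewrite mulr_sumr mulr_suml; apply: ler_sum => j _.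
  have dE1 k : d k t ^+ 2 <= E t.
    by rewrite /E (bigD1 k) //= lerDl sumr_ge0 // => l _; rewrite sqr_ge0.
  have dd : `|d i t * d j t| <= E t.
    have := sqr_ge0 (`|d i t| - `|d j t|).
    have := dE1 i; have := dE1 j; rewrite normrM.
    rewrite -(real_normK (num_real (d i t))) -(real_normK (num_real (d j t))).
    by rewrite sqrrB; lra.
  apply: le_trans (ler_norm _) _.
  have -> : 2 * d i t * (c i j t * d j t) = 2 * (c i j t * (d i t * d j t)) by ring.
  rewrite normrM (ger0_norm (x := 2)) // -[leRHS]mulrA ler_wpM2l // (normrM (c i j t)).
  by apply: ler_pM => //; exact: cC.
- by move=> t; apply: sumr_ge0 => i _; rewrite sqr_ge0.
- by apply: big1 => i _; rewrite /d uv0 subrr expr0n.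
Qed.

End QuadraticOde.

(** * The Taylor solution of the quadratic equation and its projective flow *)

Section QuadraticFlow.
Local Open Scope classical_set_scope.
Variables (R : realType) (n : nat) (b : 'I_n -> 'I_n -> 'I_n -> R).
Local Notation V := 'cV[R]_n.
Implicit Types (x y : V) (i : 'I_n) (s t : R).

(** The coefficients of [t ^ k] in [u' = quad_eval b u], solved for the coefficient of order
    [k + 1]. *)
Definition taylor_step (a : nat -> 'I_n -> R) k i : R :=
  k.+1%:R^-1 * \sum_(l < k.+1) \sum_j1 \sum_j2 b i j1 j2 * (a l j1 * a (k - l)%N j2).

Fixpoint taylor_upto x N : nat -> 'I_n -> R :=
  if N is k.+1 then fun m i =>
    if (m <= k)%N then taylor_upto x k m i else taylor_step (taylor_upto x k) k i
  else fun _ i => x i 0.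

(* The coefficient of [t ^+ k] in the solution of [u' = quad_eval b u] with  *)
(* initial value [x]; the recursion is course-of-values, hence the table.    *)
Definition taylor x k := taylor_upto x k k.

Lemma taylor_uptoE x m N : (m <= N)%N -> taylor_upto x N m = taylor x m.
Proof.
elim: N => [|N IHN]; first by rewrite leqn0 => /eqP->.
rewrite leq_eqVlt ltnS => /predU1P[-> //|mN].
by rewrite -(IHN mN); apply/funext => i /=; rewrite mN.
Qed.

Lemma taylorS x k : taylor x k.+1 = taylor_step (taylor x) k.
Proof.
apply/funext => i; rewrite /taylor /= ltnn /taylor_step; congr (_ * _).
apply: eq_bigr => l _; apply: eq_bigr => j1 _; apply: eq_bigr => j2 _.
by rewrite !taylor_uptoE ?leq_subr // -ltnS.
Qed.

Lemma taylorZ (a : R) x k i : taylor (a *: x) k i = a ^+ k.+1 * taylor x k i.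
Proof.
elim/ltn_ind: k i => -[|k] IHk i; first by rewrite /taylor /= mxE.
rewrite !taylorS /taylor_step mulrCA; congr (_ * _); rewrite mulr_sumr.
apply: eq_bigr => l _; rewrite mulr_sumr; apply: eq_bigr => j1 _.
rewrite mulr_sumr; apply: eq_bigr => j2 _.
have lk : (l <= k)%N by rewrite -ltnS.
rewrite !IHk ?ltnS ?leq_subr //.
have -> : a ^+ k.+2 = a ^+ l.+1 * a ^+ (k - l).+1.
  by rewrite -exprD addSn addnS subnKC.
ring.
Qed.

(** The added one keeps the rate positive even when [b] is zero. *)
Definition taylor_rate : R := \sum_i \sum_j \sum_k `|b i j k| + 1.
Local Notation beta := taylor_rate.

Lemma taylor_rate_gt0 : 0 < beta.
Proof. by apply: ltr_wpDl => //; do 3! [apply: sumr_ge0 => ? _]. Qed.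

Lemma norm_coord x i : `|x i 0| <= `|x|.
Proof.
rewrite [leRHS]/Num.Def.normr /= mx_normrE.
exact: (le_bigmax _ (fun ij => `|x ij.1 ij.2|) (i, 0)).
Qed.

(** By strong induction each of the [k + 1] convolution terms is at most [beta |x| ^ 2 r ^ k]; their
    number cancels the division by [k + 1]. *)
Lemma taylor_bound x k i : `|taylor x k i| <= `|x| * (beta * `|x|) ^+ k.
Proof.
elim/ltn_ind: k i => -[|k] IHk i; first by rewrite mulr1 norm_coord.
rewrite taylorS /taylor_step normrM normfV normr_nat ler_pdivrMl ?ltr0n //.
set r := beta * `|x|; have r0 : 0 <= r by rewrite mulr_ge0 // ltW // taylor_rate_gt0.
have xr : 0 <= `|x| * `|x| * r ^+ k by rewrite !mulr_ge0 // exprn_ge0.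
have -> : k.+1%:R * (`|x| * r ^+ k.+1) =
    \sum_(l < k.+1) beta * (`|x| * `|x| * r ^+ k).
  by rewrite sumr_const card_ord -[_ *+ k.+1]mulr_natl exprS {1}/r; ring.
apply: le_trans (ler_norm_sum _ _ _) _; apply: ler_sum => l _.
apply: (@le_trans _ _ (\sum_j1 \sum_j2 `|b i j1 j2| * (`|x| * `|x| * r ^+ k))).
  apply: le_trans (ler_norm_sum _ _ _) _; apply: ler_sum => j1 _.
  apply: le_trans (ler_norm_sum _ _ _) _; apply: ler_sum => j2 _.
  rewrite normrM ler_wpM2l // normrM.
  have -> : r ^+ k = r ^+ l * r ^+ (k - l) by rewrite -exprD subnKC // -ltnS.
  rewrite mulrACA; apply: ler_pM => //; apply: IHk => //.
  by rewrite ltnS leq_subr.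
under eq_bigr do rewrite -mulr_suml.
rewrite -mulr_suml ler_wpM2r // /taylor_rate [in leRHS](bigD1 i) //= -addrA lerDl.
by apply: addr_ge0 => //; do 3! [apply: sumr_ge0 => ? _].
Qed.

Definition flow_coord x i t : R := limn (pseries (fun k => taylor x k i) t).

Let rate_ge0 x : 0 <= beta * `|x|.
Proof. by rewrite mulr_ge0 // ltW // taylor_rate_gt0. Qed.

Lemma flow_coord0 x i : flow_coord x i 0 = x i 0.
Proof.
(* The empty partial sum is zero; the partial sums are constant only from the first term on, hence
   the shift. *)
apply: cvg_lim => //; rewrite -cvg_shiftS.
apply: (@cvg_near_cst _ _ _ _ _ _); apply: nearW => N /=.
rewrite /pseries /series /= big_nat_recl //= expr0 mulr1 big1 ?addr0 // => k _.
by rewrite expr0n mulr0.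
Qed.

(** By homogeneity the [k]-th coefficient at [t x] is [t] times the [k]-th term at time [t], so
    time-one values determine the whole flow projectively. *)
Lemma flow_coordZ x i t : beta * `|x| * `|t| < 1 ->
  flow_coord (t *: x) i 1 = t * flow_coord x i t.
Proof.
move=> tx; apply: cvg_lim => //.
have -> : pseries (fun k => taylor (t *: x) k i) 1 =
    (fun N => t * pseries (fun k => taylor x k i) t N).
  apply/funext => N; rewrite /pseries /series /= mulr_sumr.
  by apply: eq_bigr => k _; rewrite taylorZ expr1n mulr1 exprS; ring.
apply: cvgMl_tmp; exact: cvg_pseries_geom (fun k => taylor_bound x k i) _ tx.
Qed.

(** Differentiation cancels the division by [k + 1] in the recursion, leaving Cauchy products that
    converge to products of coordinates. *)
Lemma flow_coord_is_derive x i t : beta * `|x| * `|t| < 1 ->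
  is_derive t 1 (flow_coord x i) (quad_eval b (fun j => flow_coord x j t) i).
Proof.
move=> tx; have bnd j k := taylor_bound x k j.
have D := is_derive_pseries_geom (bnd i) (rate_ge0 x) tx.
apply: (is_derive_eq D); apply: cvg_lim => //.
have -> : pseries (pseries_diffs (fun k => taylor x k i)) t = fun N =>
    \sum_j1 \sum_j2 b i j1 j2 * pseries (cauchy_product
      (fun k => taylor x k j1) (fun k => taylor x k j2)) t N.
  apply/funext => N; rewrite /pseries /series /=.
  under [RHS]eq_bigr do under eq_bigr do rewrite mulr_sumr.
  under [RHS]eq_bigr do rewrite exchange_big.
  rewrite [RHS]exchange_big; apply: eq_bigr => k _ /=.
  rewrite /pseries_diffs taylorS /taylor_step mulVKf ?pnatr_eq0 //.
  rewrite exchange_big mulr_suml; apply: eq_bigr => j1 _.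
  rewrite exchange_big mulr_suml; apply: eq_bigr => j2 _ /=.
  by rewrite /cauchy_product -mulr_sumr mulrA.
rewrite /quad_eval.
apply: cvg_big => [|j1 _]; first exact: add_continuous.
apply: cvg_big => [|j2 _]; first exact: add_continuous.
 apply: cvgMl_tmp.
by apply: pseries_cauchy_product (bnd j1) (bnd j2) _ tx.
Qed.

Definition flow_domain : set V := [set x | beta * `|x| < 1].

Definition quad_flow x : V := \col_i flow_coord x i 1.

Lemma phi_defP t x : phi_def flow_domain t x <-> beta * `|x| * `|t| < 1.
Proof.
rewrite /phi_def /flow_domain /= normrZ (mulrC `|t|) mulrA.
by split=> [[->|//]|]; [rewrite normr0 mulr0 | right].
Qed.

Lemma phi_tE t x : beta * `|x| * `|t| < 1 ->
  phi_t quad_flow t x = \col_i flow_coord x i t.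
Proof.
move=> tx; rewrite /phi_t; case: eqVneq => [->|t0].
  by apply/colP => i; rewrite mxE flow_coord0.
by apply/colP => i; rewrite !mxE flow_coordZ // mulKf.
Qed.

Lemma near0_small x : \forall t \near (0 : R), beta * `|x| * `|t| < 1.
Proof.
have b0 : 0 < (beta * `|x| + 1)^-1 by rewrite invr_gt0 ltr_wpDl.
near=> t; have : `|t| < (beta * `|x| + 1)^-1.
  near: t; exact: (@nbhs0_lt _ R).
rewrite -[_^-1]mul1r ltr_pdivlMr ?ltr_wpDl // => h.
apply: le_lt_trans h; rewrite mulrC ler_wpM2l // lerDl //.
Unshelve. all: by end_near. Qed.

Lemma flow_base_domain x : flow_base flow_domain x.
Proof.
(* A time bound valid for all [y] with [|y| < |x| + 1] at once. *)
pose c := (beta * (`|x| + 1))^-1.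
have b0 := taylor_rate_gt0; have x1 : 0 < `|x| + 1 by rewrite ltr_wpDl.
have c0 : 0 < c by rewrite invr_gt0 mulr_gt0.
exists ([set y | `|y| < `|x| + 1], [set t | `|t| < c]) => /=.
  split; last exact: (@nbhs0_lt _ R).
  by apply: (@cvgr_norm_lt _ V V (nbhs x) _ id x _); rewrite ?ltrDl //; exact: cvg_id.
move=> [y t] /= [yx tc]; apply/phi_defP.
have [->|t0] := eqVneq t 0; first by rewrite normr0 mulr0.
apply: (@lt_le_trans _ _ (beta * (`|x| + 1) * `|t|)).
  by rewrite ltr_pM2r ?normr_gt0 // ltr_pM2l.
by rewrite mulrC -ler_pdivlMr ?mulr_gt0 // div1r ltW.
Unshelve. all: by end_near. Qed.

Lemma quad_flow_is_derive x :
  is_derive (0 : R) 1 (fun t => phi_t quad_flow t x)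
    (\col_i quad_eval b (fun j => x j 0) i).
Proof.
apply: (@near_eq_is_derive _ _ _ (fun t => \col_i flow_coord x i t)).
  near=> t; rewrite phi_tE //; near: t; exact: near0_small.
have D i : is_derive (0 : R) 1 (flow_coord x i) (quad_eval b (fun j => x j 0) i).
  apply: (is_derive_eq (flow_coord_is_derive i _)).
    by rewrite normr0 mulr0.
  by congr quad_eval; apply/funext => j; rewrite flow_coord0.
have dM : derivable (fun t => \col_i flow_coord x i t) (0 : R) 1.
  apply/derivable_mxP => i j; have [+ _] := D i.
  by under [X in _ -> derivable X _ _]funext do rewrite mxE.
apply: DeriveDef => //; rewrite derive_mx //; apply/matrixP => i j; rewrite !mxE.
have [_ Di] := D i.
have -> : (fun t => (\col_i flow_coord x i t) i j) = flow_coord x i.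
  by apply/funext => t; rewrite mxE.
exact: Di.
Unshelve. all: by end_near. Qed.

Lemma quad_flow_projective : projective_flow flow_domain quad_flow.
Proof.
split; first by exists 0; exact: flow_base_domain.
- move=> x _; have [D _] := quad_flow_is_derive x.
  have C : {for 0, continuous (fun t : R => phi_t quad_flow t x)}.
    exact/differentiable_continuous/derivable1_diffP.
  have p0 : phi_t quad_flow 0 x = x by rewrite /phi_t eqxx.
  have {C p0} C : phi_t quad_flow t x @[t --> 0] --> x by rewrite -{2}p0.
  have : phi_t quad_flow t x @[t --> 0^'] --> x.
    exact: cvg_within_filter C.
  apply: cvg_trans; apply: near_eq_cvg.
  near=> t; rewrite /phi_t ifN //; near: t; exact: nbhs_dnbhs_neq.
move=> x s t /phi_defP sx; rewrite (phi_tE sx); set y := \col_i _.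
move=> /phi_defP ty /phi_defP tsx; rewrite (phi_tE ty) (phi_tE tsx).
apply/colP => i; rewrite !mxE.
(* Both curves solve [u' = t * quad_eval b u] for [a] in the unit interval and start at [y]; the
   claim is their equality at [a = 1]. *)
have H := @quad_ode_unique _ _ b t (fun i a => flow_coord x i (s + a * t))
  (fun i a => flow_coord y i (a * t)).
have aff (c a : R) : is_derive a 1 (fun a => c + a * t) t.
  apply: is_derive_eq; rewrite /GRing.scale /=; ring.
rewrite -[t]mul1r addrC; apply: H.
- move=> j a a01.
  (* [s + a t] is a convex combination of [s] and [t + s], where the bound holds by hypothesis. *)
  have sat : beta * `|x| * `|s + a * t| < 1.
    have /andP[a0 a1] := a01.
    pose m := Num.max (beta * `|x| * `|s|) (beta * `|x| * `|t + s|).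
    have m1 : m < 1 by rewrite gt_max sx tsx.
    apply: le_lt_trans m1.
    have -> : s + a * t = (1 - a) * s + a * (t + s) by ring.
    apply: (@le_trans _ _
      ((1 - a) * (beta * `|x| * `|s|) + a * (beta * `|x| * `|t + s|))).
      have -> : (1 - a) * (beta * `|x| * `|s|) + a * (beta * `|x| * `|t + s|) =
          beta * `|x| * (`|(1 - a) * s| + `|a * (t + s)|).
        have a1' : 0 <= 1 - a by rewrite subr_ge0.
        by rewrite (normrM a) (normrM (1 - a)) (ger0_norm a0) (ger0_norm a1'); ring.
      by rewrite ler_wpM2l ?ler_normD.
    have -> : m = (1 - a) * m + a * m by ring.
    by apply: lerD; apply: ler_wpM2l; rewrite ?subr_ge0 // le_max lexx ?orbT.
  apply: is_derive_eq.
    exact: (@is_derive1_comp _ _ (fun a => s + a * t) _ _ _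
      (flow_coord_is_derive j sat) (aff s a)).
  by rewrite mulrC.
- move=> j a a01.
  have ya : beta * `|y| * `|a * t| < 1.
    have /andP[a0 a1] := a01; apply: le_lt_trans ty.
    by rewrite normrM (ger0_norm a0) ler_wpM2l // ler_piMl.
  have lin : is_derive a 1 (fun a => a * t) t.
    by apply: is_derive_eq; rewrite /GRing.scale /=; ring.
  apply: is_derive_eq.
    exact: (@is_derive1_comp _ _ (fun a => a * t) _ _ _ (flow_coord_is_derive j ya) lin).
  by rewrite mulrC.
by move=> j; rewrite !mul0r addr0 flow_coord0 /y mxE.
Unshelve. all: by end_near. Qed.

End QuadraticFlow.

(** * The representation of [S_n x Z_2]: faithfulness and reducibility *)

Section ReflectedPermutations.
Variables (R : realType) (n : nat).
Hypothesis n_ge3 : (3 <= n)%N.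
Local Notation z := (mean_reflection R n).

Definition reflected_perm_mx (g : 'S_n * 'Z_2) : 'M[R]_n :=
  perm_mx g.1 *m (if g.2 == 0 then 1%:M else z).

Lemma perm_mx_const (s : 'S_n) (c : R) : perm_mx s *m const_mx c = const_mx c :> 'M[R]_n.
Proof. by rewrite -row_permE; apply/matrixP => i j; rewrite !mxE. Qed.

Lemma const_mx_perm (s : 'S_n) (c : R) : const_mx c *m perm_mx s = const_mx c :> 'M[R]_n.
Proof. by rewrite -[s]invgK -col_permE; apply/matrixP => i j; rewrite !mxE. Qed.

Lemma mean_reflection_perm (s : 'S_n) : z *m perm_mx s = perm_mx s *m z.
Proof.
by rewrite /mean_reflection mulmxBl mulmxBr mul1mx mulmx1 perm_mx_const const_mx_perm.
Qed.

Lemma reflected_perm_mx_repr : mx_repr [set: 'S_n * 'Z_2] reflected_perm_mx.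
Proof.
split=> [|[s e] [s' e'] _ _]; first by rewrite /reflected_perm_mx /= perm_mx1 mulmx1.
rewrite /reflected_perm_mx /= perm_mxM.
case: e e' => [[|[|//]] le] [[|[|//]] le'] /=; rewrite ?mulmx1 //.
- by rewrite mulmxA.
- by rewrite -!mulmxA mean_reflection_perm.
by rewrite -!mulmxA (mulmxA z) mean_reflection_perm -mulmxA mean_reflection_sqr // mulmx1.
Qed.

Definition reflected_perm_repr : mx_representation R [set: 'S_n * 'Z_2]%G n :=
  MxRepresentation reflected_perm_mx_repr.

(** Without the reflection, a kernel element is a permutation matrix with unit diagonal. With it,
    the reflection would be a permutation matrix, against its negative off-diagonal entries
    [- 2 / n]. *)
Lemma reflected_perm_repr_faithful : mx_faithful reflected_perm_repr.
Proof.
rewrite /mx_faithful; apply/fintype.subsetP => -[s e] /rkerP [_].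
rewrite /= /reflected_perm_mx /= inE.
have [-> sE|_ sE] := eqVneq e 0.
  rewrite mulmx1 in sE; apply/eqP; congr (_, _); apply/permP => i; rewrite perm1.
  have := congr1 (fun A : 'M[R]_n => A i i) sE; rewrite /= !mxE eqxx.
  by case: eqP => // _ /eqP; rewrite eq_sym oner_eq0.
have sz : perm_mx s = z.
  by rewrite -[LHS]mulmx1 -(mean_reflection_sqr R n_ge3) mulmxA sE mul1mx.
pose i := Ordinal (ltn_trans (isT : (0 < 2)%N) n_ge3).
pose j := Ordinal (ltn_trans (isT : (1 < 2)%N) n_ge3).
have := congr1 (fun A : 'M[R]_n => A i j) sz; rewrite /= mean_reflectionE sub0r.
have : 0 < 2 / n%:R :> R by rewrite divr_gt0 // ltr0n; case: n n_ge3.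
rewrite !mxE; case: eqP => _ /=; lra.
Qed.

(** The group acts on the all-ones row by signs. Irreducibility would give the matrix [J], of rank
    at most one, the rank [n >= 3]. *)
Lemma reflected_perm_repr_reducible : complex_reducible reflected_perm_repr.
Proof.
move=> irr_n.
pose f := real_complex R.
pose J : 'M[R]_n := const_mx 1.
have Jg g : exists c : R, J *m reflected_perm_mx g = c *: J.
  rewrite /reflected_perm_mx mulmxA const_mx_perm; case: ifP => _.
    by exists 1; rewrite mulmx1 scale1r.
  exists (-1); apply/matrixP => i j; rewrite !mxE.
  under eq_bigr do rewrite mean_reflectionE mxE mul1r.
  rewrite sumrB (bigD1 j) //= eqxx big1 => [|l /negbTE->//].
  rewrite sumr_const card_ord -[_ *+ n]mulr_natl.
  have n0 : n%:R != 0 :> R by rewrite pnatr_eq0; case: n n_ge3.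
  rewrite -[true%:R]/(1 : R); by field.
have Jmod : mxmodule (map_repr f reflected_perm_repr) (map_mx f J).
  apply/mxmoduleP => g _; rewrite /= -map_mxM.
  by have [c ->] := Jg g; rewrite map_mxZ scalemx_sub.
have J0 : map_mx f J != 0.
  pose i := Ordinal (ltn_trans (isT : (0 < 2)%N) n_ge3).
  apply/eqP => /matrixP/(_ i i); rewrite !mxE => -[] /eqP.
  by rewrite oner_eq0.
have JE : map_mx f J = const_mx 1 *m (const_mx 1 : 'rV_n).
  by apply/matrixP => i j; rewrite !mxE big_ord_recl big_ord0 !mxE addr0 mulr1.
have := mxrankM_maxr (const_mx 1 : 'cV_n) (const_mx 1 : 'rV[R[i]%C]_n).
have [_ _ irr] := irr_n; have /mxrankS := irr _ Jmod (submx1 _) J0.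
rewrite mxrank1 -JE => nJ J1; have := leq_trans (leq_trans nJ J1) (rank_leq_row _).
by rewrite leqNgt (leq_trans _ n_ge3).
Qed.

End ReflectedPermutations.

(** * The superflow generated by the centered square *)

Theorem proposition1 (R : realType) (n : nat) (n_ge3 : (3 <= n)%N) :
  exists (gT : finGroupType) (G : {group gT}) (rG : mx_representation R G n)
         (D : set 'cV[R]_n) (Phi : 'cV[R]_n -> 'cV[R]_n),
    [/\ superflow rG D Phi,
        complex_reducible rG,
        #|G| = (2 * n`!)%N
      & G \isog [set: 'S_n * 'Z_2]].
Proof.
pose b := @centered_square R n; pose Q := quad_vfield b.
pose i0 := Ordinal (ltn_trans (isT : (0 < 2)%N) n_ge3).
have bS : symmetric_array b := @centered_square_sym R n.
have b0 : b i0 i0 i0 != 0 := centered_square_neq0 R n_ge3 i0.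
exists _, [set: 'S_n * 'Z_2]%G, (reflected_perm_repr R n_ge3).
exists (flow_domain b), (quad_flow b).
split; last exact: isog_refl; last first.
- by rewrite cardsT card_prod card_Sn card_ord mulnC.
- exact: reflected_perm_repr_reducible.
split; first exact: ltnW.
- exact: reflected_perm_repr_faithful.
- exact: quad_flow_projective.
exists Q; split.
- move=> x v Qv; split; first exact: flow_base_domain.
  have -> : v = \col_i quad_eval b (fun j => x j 0) i.
    by apply/colP => i; rewrite mxE (quad_vfield_value Qv).
  exact: quad_flow_is_derive.
- by apply: contra_neq b0 => Q0; rewrite (quad_vfield_eq0 bS Q0).
- exact: quad_vfield_homog2.
- move=> g gG; apply/quad_vfield_invariant => //; first exact: repr_mx_unit gG.
  apply: equivariant_arrayM; first exact: centered_square_perm.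
  by case: ifP => _; [exact: equivariant_array1 | exact: centered_square_refl].
(* Positive denominator degree gives the second alternative, as [Q] has degree zero; otherwise [Q']
   is quadratic and uniqueness up to a scalar applies. *)
move=> Q' Q'h Q'inv; have [[|d'] Qd'] := denom_degree_exists Q'; last first.
  by right; exists 0%N, d'.+1; split=> //; exact: quad_vfield_denom_degree.
left; have [b' b'S Q'E] := denom_degree0_quad Q'h Qd'.
have b'G g : equivariant_array (reflected_perm_repr R n_ge3 g) b'.
  have gG : g \in [set: 'S_n * 'Z_2] by rewrite inE.
  apply/quad_vfield_invariant => //; first exact: repr_mx_unit gG.
  by rewrite -Q'E; exact: Q'inv.
(* The pairs [(s, 0)] and [(1, 1)] recover the permutations and the reflection. *)
have b'_perm s : equivariant_array (perm_mx s) b'.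
  by have := b'G (s, 0); rewrite /= /reflected_perm_mx /= mulmx1.
have b'_refl : equivariant_array (mean_reflection R n) b'.
  by have := b'G (1%g, 1); rewrite /= /reflected_perm_mx /= perm_mx1 mul1mx.
have [c b'E] := equivariant_array_unique bS b'S (@centered_square_perm R n)
  b'_perm (centered_square_refl R n_ge3) b'_refl b0.
exists c; rewrite Q'E quad_vfieldZ; apply/colP => i; rewrite !mxE.
by congr FracField.tofrac; apply: eq_quad_poly => j k.
Qed.
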